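(* Let $(X,d)$ be a metric space in which all Bourbaki bounded sets are precompact. If $U(X)$ is a ring, then there is a precompact set $L\subset X$ such that for each $\varepsilon>0$, the set $X\setminus B(L,\varepsilon)$ is uniformly isolated in $X$.
   Context: $U(X)$ is the set of all real-valued uniformly continuous functions on $(X,d)$; ''$U(X)$ is a ring'' means it is closed under pointwise product. A set $A\subset X$ is Bourbaki bounded (in $X$) if every $f\in U(X)$ is bounded on $A$. Precompact means totally bounded. $B(L,\varepsilon)=\{x\in X: d(x,y)<\varepsilon\text{ for some }y\in L\}$ is the $\varepsilon$-enlargement of $L$. A set $A\subset X$ is uniformly isolated in $X$ if there is $\eta>0$ such that $\{y\in X:d(x,y)<\eta\}=\{x\}$ for every $x\in A$. *)

(* Defs.v *)
From HB Require Import structures.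
From mathcomp Require Import all_boot all_order all_algebra.
From mathcomp Require Import all_classical all_reals all_analysis.

Set Implicit Arguments.
Unset Strict Implicit.
Unset Printing Implicit Defensive.

Import Order.TTheory GRing.Theory Num.Theory.
Import numFieldNormedType.Exports.

Local Open Scope classical_set_scope.
Local Open Scope ring_scope.

Section UniformlyContinuousFunctions.
Context {R : realType} (X : metricType R).

Definition ucfun : set (X -> R) := [set f | unif_continuous f].

(* Only the product needs to be required: uniformly continuous real functions
   always form a vector space containing the constants. *)
Definition ucfun_ring : Prop :=
  forall f g : X -> R, ucfun f -> ucfun g -> ucfun (f \* g).

End UniformlyContinuousFunctions.

Section MetricSets.
Context {R : realType} {X : metricType R}.
Implicit Types A L : set X.

Definition bourbaki_bounded A : Prop :=
  forall f : X -> R, ucfun f -> [bounded f x | x in A].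

Definition enlargement L (e : R) : set X :=
  [set x | exists2 y, L y & mdist x y < e].

(* The library's [precompact] means "contained in a closed compact set", which
   is stronger than total boundedness when the space is not complete. *)
Definition totally_bounded A : Prop :=
  forall e : R, 0 < e -> exists2 F : set X, finite_set F & A `<=` enlargement F e.

Definition uniformly_isolated A : Prop :=
  exists2 eta : R, 0 < eta &
    forall x, A x -> [set y | mdist x y < eta] = [set x].

End MetricSets.

(* Main.v *)
(* Let [A n] be the set of points having another point at distance [< 1/(n+1)].
   Each [e > 0] admits an [n] such that [A n] has a finite [e]-net; the union [L]
   of such nets for [e = 1/(k+1)] is then the required set. Otherwise one picks
   greedily an [e]-separated sequence [x n] in [A n]. Its range is not totally
   bounded, so some uniformly continuous [f] is unbounded on it. Along a
   subsequence [|f (x n)| >= n+1], and the supremum [g] of narrow bumps of height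
   [1/(n+1)] centered at the [x n] and vanishing at close neighbours [y n] is
   uniformly continuous, but [f * g] is not. *)

Require Import Defs.
From HB Require Import structures.
From mathcomp Require Import all_boot all_order all_algebra.
From mathcomp Require Import all_classical all_reals all_analysis.
From mathcomp Require Import lra.

Set Implicit Arguments.
Unset Strict Implicit.
Unset Printing Implicit Defensive.

Import Order.TTheory GRing.Theory Num.Theory.
Import numFieldNormedType.Exports.

Local Open Scope classical_set_scope.
Local Open Scope ring_scope.

Lemma invSn_lt (R : realType) (e : R) : 0 < e -> exists n : nat, n.+1%:R^-1 < e.
Proof.
move=> e0; exists (Num.truncn e^-1).
by rewrite invf_plt ?posrE// truncnS_gt.
Qed.

Lemma le_invSn (R : realType) (m n : nat) :
  (m <= n)%N -> n.+1%:R^-1 <= m.+1%:R^-1 :> R.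
Proof. by move=> mn; rewrite lef_pV2 ?posrE// ler_nat. Qed.

(** * Bumps and their suprema *)

Section UniformContinuity.
Context {R : realType} (X : metricType R).
Implicit Types (f : X -> R) (x y : X).

Lemma ucfunP f : ucfun f <-> forall e : R, 0 < e ->
  exists2 d : R, 0 < d & forall x y, mdist x y < d -> `|f x - f y| < e.
Proof.
rewrite /ucfun /= unif_continuousP; split=> H e e0.
  have [d /= d0 dH] := H e e0; exists d => // x y xy.
  by have := dH (x, y); rewrite /= ballEmdist; apply.
have [d d0 dH] := H e e0; exists d => //= -[x y] /=.
by rewrite ballEmdist => /dH.
Qed.

Lemma lipschitz_ucfun f (K : R) : 0 < K ->
  (forall x y, f x - f y <= K * mdist x y) -> ucfun f.
Proof.
move=> K0 fK; apply/ucfunP => e e0; exists (e / K); first exact: divr_gt0.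
move=> x y; rewrite ltr_pdivlMr// mulrC => xy.
rewrite ltr_norml; have := fK x y; have := fK y x; rewrite (metric_sym y).
lra.
Qed.

Definition bump (x : X) (r c : R) : X -> R :=
  fun z => c * Num.max 0 (1 - mdist x z / r).

Lemma ucfun_bump x (r c : R) : 0 < r -> 0 < c -> ucfun (bump x r c).
Proof.
move=> r0 c0; apply: (@lipschitz_ucfun _ (c / r)); first exact: divr_gt0.
move=> z w; rewrite /bump -mulrBr -mulrA ler_pM2l//.
have : mdist x w / r <= mdist x z / r + r^-1 * mdist z w.
  rewrite [r^-1 * _]mulrC -mulrDl ler_pM2r ?invr_gt0//.
  exact: metric_triangle.
have : 0 <= r^-1 * mdist z w by rewrite mulr_ge0 ?mdist_ge0// invr_ge0 ltW.
rewrite !maxEle; case: ifPn; case: ifPn; lra.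
Qed.

Lemma bump_ge0 x (r c : R) z : 0 < c -> 0 <= bump x r c z.
Proof. by move=> c0; rewrite mulr_ge0 ?(ltW c0)// le_max lexx. Qed.

Lemma bump_le x (r c : R) z : 0 < r -> 0 < c -> bump x r c z <= c.
Proof.
move=> r0 c0; rewrite /bump -[leRHS]mulr1 ler_pM2l// ge_max ler01/= gerBl.
by rewrite divr_ge0 ?mdist_ge0// ltW.
Qed.

Lemma bump_center x (r c : R) : bump x r c x = c.
Proof. by rewrite /bump mdistxx mul0r subr0 max_r ?mulr1. Qed.

Lemma bump_far x (r c : R) z : 0 < r -> r <= mdist x z -> bump x r c z = 0.
Proof.
by move=> r0 xz; rewrite /bump max_l ?mulr0// subr_le0 ler_pdivlMr// mul1r.
Qed.

Lemma ucfun_equi (g : nat -> X -> R) (N : nat) (e : R) : 0 < e ->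
  (forall n, ucfun (g n)) ->
  exists2 d : R, 0 < d & forall n x y, (n < N)%N -> mdist x y < d ->
    `|g n x - g n y| < e.
Proof.
move=> e0 gu; elim: N => [|N [d d0 dg]]; first by exists 1.
have /ucfunP/(_ e e0)[d' d'0 dg'] := gu N.
exists (Num.min d d'); first by rewrite lt_min d0.
move=> n x y; rewrite ltnS leq_eqVlt lt_min => /orP[/eqP->|nN] /andP[xd xd'].
  exact: dg'.
exact: dg.
Qed.

(** For [n >= N] the functions are too small to raise the supremum by more than [e / 2], and the
    finitely many others share a modulus of continuity. *)
Lemma ucfun_sup (g : nat -> X -> R) : (forall n, ucfun (g n)) ->
  (forall n x, 0 <= g n x <= n.+1%:R^-1) ->
  ucfun (fun x => sup (range (g^~ x))).
Proof.
move=> gu gb; apply/ucfunP => e e0.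
have e20 : 0 < e / 2 by rewrite divr_gt0.
have [N Ne] := invSn_lt e20.
have [d d0 dg] := ucfun_equi N e20 gu.
have gsup x n : g n x <= sup (range (g^~ x)).
  apply: ub_le_sup; last by exists n.
  exists 1 => _ [m _ <-]; have /andP[_ /le_trans->]// := gb m x.
  by rewrite invf_le1 ?ler1n.
suff H x y : mdist x y < d ->
    sup (range (g^~ x)) <= sup (range (g^~ y)) + e / 2.
  exists d => // x y xy.
  have := H _ _ xy; rewrite metric_sym in xy; have := H _ _ xy.
  by rewrite ltr_norml; lra.
move=> xy; apply: ge_sup; first by exists (g 0 x), 0.
move=> _ [n _ <-]; have := gsup y n.
have [nN|Nn] := ltnP n N.
  by have := dg n x y nN xy; rewrite ltr_norml; lra.
have /andP[gy0 _] := gb n y; have /andP[_ gx] := gb n x.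
have := le_lt_trans (le_trans gx (le_invSn R Nn)) Ne.
lra.
Qed.

(* The supremum of bumps of height [1/(n+1)] around the [x n] is uniformly
   continuous whatever their slopes; multiplied by [f] it jumps by at least [1]
   between the [x n] and the [y n]. *)
Lemma ucfun_ring_bumps f (x y : nat -> X) : ucfun_ring X -> ucfun f ->
  (forall n, n.+1%:R <= `|f (x n)|) ->
  (forall n, y n != x n) ->
  (forall n, mdist (x n) (y n) < n.+1%:R^-1) ->
  (forall m n, mdist (x m) (y m) <= mdist (x m) (y n)) -> False.
Proof.
move=> ring fu fx yx xy sep.
have r0 n : 0 < mdist (x n) (y n) by rewrite mdist_gt0 eq_sym.
have c0 n : 0 < n.+1%:R^-1 :> R by rewrite invr_gt0.
pose g n := bump (x n) (mdist (x n) (y n)) n.+1%:R^-1.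
have gb n z : 0 <= g n z <= n.+1%:R^-1 by rewrite bump_ge0//= bump_le.
have gu n : ucfun (g n) by exact: ucfun_bump.
pose h z := sup (range (g^~ z)).
have hx n : n.+1%:R^-1 <= h (x n).
  apply: ub_le_sup; last by exists n => //; exact: bump_center.
  exists 1 => _ [m _ <-]; have /andP[_ /le_trans->]// := gb m (x n).
  by rewrite invf_le1 ?ler1n.
(* By [sep] each bump vanishes at every [y n]; the radius of the [n]-th one is exactly the distance
   from [x n] to [y n]. *)
have hy n : h (y n) = 0.
  suff gy : range (g^~ (y n)) = [set 0] by rewrite /h gy sup1.
  apply/seteqP; split => [_ [m _ <-]|_ ->]; first by rewrite /g bump_far.
  by exists 0 => //; rewrite /g bump_far.
have /ucfunP/(_ 1 ltr01)[d d0 dfh] := ring f h fu (ucfun_sup gu gb).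
have [n nd] := invSn_lt d0.
have := dfh (x n) (y n) (lt_trans (xy n) nd).
rewrite /= hy mulr0 subr0 normrM ltNge => /negP; apply.
have <- : n.+1%:R * n.+1%:R^-1 = 1 :> R by rewrite divff.
by rewrite ler_pM// (le_trans (hx n))// ler_norm.
Qed.

End UniformContinuity.

(** * Separated sequences with close neighbours *)

Section Separated.
Context {R : realType} (X : metricType R).
Implicit Types (x y : nat -> X) (e : R).

(** Two terms within [e / 2] of the same net point would be less than [e] apart, so a finite
    [e / 2]-net would receive an injection from [nat]. *)
Lemma separated_not_totally_bounded x e : 0 < e ->
  (forall m n, (m < n)%N -> e <= mdist (x m) (x n)) ->
  ~ totally_bounded (range x).
Proof.
move=> e0 sep /(_ (e / 2))[|F Ff xF]; first by rewrite divr_gt0.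
have /choice[p pP] n : exists z, F z /\ mdist (x n) z < e / 2.
  by have [|z] := xF (x n); [exists n|exists z].
have pinj m n : (m < n)%N -> p m <> p n.
  move=> mn pmn; have := sep m n mn; apply/negP; rewrite -ltNge.
  have [_ pm] := pP m; have [_ pn] := pP n.
  have := metric_triangle (x m) (p m) (x n).
  by rewrite [mdist (p m) _]metric_sym [in X in _ + X]pmn; lra.
apply: infinite_nat; rewrite (_ : setT = p @^-1` F).
  apply: finite_preimage => // m n _ _ pmn.
  by case: (ltngtP m n) => // /pinj; rewrite pmn.
by apply/seteqP; split => // n _; case: (pP n).
Qed.

Lemma unbounded_range x (f : X -> R) : ~ [bounded f z | z in range x] ->
  forall n : nat, exists2 m, (n <= m)%N & n.+1%:R <= `|f (x m)|.
Proof.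
move=> nb n; apply: contrapT => H; apply: nb.
apply/ex_bound; first by apply: (@globally_properfilter _ _ (x 0)); exists 0.
(* The first summand bounds the terms from [n] on, the sum bounds the earlier ones. *)
exists (n.+1%:R + \sum_(i < n) `|f (x i)|) => _ [m _ <-] /=.
have [nm|mn] := leqP n m.
  rewrite ler_wpDr ?sumr_ge0// leNgt; apply/negP => /ltW ?.
  by apply: H; exists m.
by rewrite ler_wpDl// (bigD1 (Ordinal mn))//= ler_wpDr// sumr_ge0.
Qed.

Lemma separated_isolated x y e :
  (forall A : set X, bourbaki_bounded A -> totally_bounded A) ->
  ucfun_ring X -> 0 < e ->
  (forall m n, (m < n)%N -> e <= mdist (x m) (x n)) ->
  (forall n, y n != x n) ->
  (forall n, mdist (x n) (y n) < n.+1%:R^-1) -> False.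
Proof.
move=> hbb ring e0 sep yx xy.
have /existsNP[f /not_implyP[fu fnb]] : ~ bourbaki_bounded (range x).
  by move=> /hbb; exact: separated_not_totally_bounded e0 sep.
have [N Ne] : exists n : nat, n.+1%:R^-1 < e / 2.
  by apply: invSn_lt; rewrite divr_gt0.
(* [s] need not be injective: a repeated index only repeats a bump center and its neighbour. *)
have /choice[s sP] n : exists m, [/\ (n <= m)%N, (N <= m)%N & n.+1%:R <= `|f (x m)|].
  have [m + fm] := unbounded_range fnb (maxn n N).
  rewrite geq_max => /andP[nm Nm]; exists m; split => //.
  by rewrite (le_trans _ fm)// ler_nat ltnS leq_maxl.
have close m : (N <= m)%N -> mdist (x m) (y m) < e / 2.
  by move=> Nm; exact: lt_trans (lt_le_trans (xy m) (le_invSn R Nm)) Ne.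
apply: (@ucfun_ring_bumps _ _ f (x \o s) (y \o s)) => //=.
- by move=> n; have [] := sP n.
- move=> n; have [ns _ _] := sP n.
  exact: lt_le_trans (xy (s n)) (le_invSn R ns).
(* For distinct indices, [y (s n)] is more than [e - e / 2] away from [x (s m)], while [y (s m)] is
   closer than [e / 2]. *)
- move=> m n; have [->//|smn] := eqVneq (s m) (s n).
  have {smn} : e <= mdist (x (s m)) (x (s n)).
    by move: smn; rewrite neq_ltn => /orP[|] /sep//; rewrite metric_sym.
  have [_ /close xym _] := sP m; have [_ /close xyn _] := sP n.
  have := metric_triangle (x (s m)) (y (s n)) (x (s n)).
  rewrite [mdist (y _) _]metric_sym; lra.
Qed.

End Separated.

(** * Finite nets for the points with close neighbours *)

Section NearlyIsolated.
Context {R : realType} (X : metricType R).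

Definition near_points (n : nat) : set X :=
  [set x | exists2 y, y != x & mdist x y < n.+1%:R^-1].

Lemma near_points_le m n : (m <= n)%N -> near_points n `<=` near_points m.
Proof.
move=> mn x [y yx xy]; exists y => //.
exact: lt_le_trans xy (le_invSn R mn).
Qed.

Lemma isolated_near_points n (A : set X) :
  A `<=` ~` near_points n -> uniformly_isolated A.
Proof.
move=> An; exists n.+1%:R^-1; first by rewrite invr_gt0.
move=> x /An xn; apply/seteqP; split => [y xy|_ ->] /=; last first.
  by rewrite mdistxx invr_gt0.
by apply: contrapT => yx; apply: xn; exists y => //; exact/eqP.
Qed.

Lemma near_points_net (e : R) :
  (forall A : set X, bourbaki_bounded A -> totally_bounded A) ->
  ucfun_ring X -> 0 < e ->
  exists n, exists2 F : set X, finite_set F & near_points n `<=` enlargement F e.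
Proof.
move=> hbb ring e0; apply: contrapT => H.
have /choice[G GP] (p : nat * seq X) : exists x,
    near_points p.1 x /\ ~ enlargement [set` p.2] e x.
  apply: contrapT => Hp; apply: H; exists p.1, [set` p.2]; first exact: finite_seq.
  by move=> x xp; apply: contrapT => xe; apply: Hp; exists x.
(* [l n] lists the points chosen before stage [n]; the next one avoids their [e]-enlargement and
   lies in [near_points n], so that its neighbour gets closer as [n] grows. *)
pose l := fix l n := if n is m.+1 then G (m, l m) :: l m else [::].
pose x n := G (n, l n).
have xl m n : (m < n)%N -> x m \in l n.
  elim: n => // n IHn; rewrite ltnS leq_eqVlt inE => /orP[/eqP->|/IHn->].
    by rewrite eqxx.
  by rewrite orbT.
have /choice[y yP] n : exists z, z != x n /\ mdist (x n) z < n.+1%:R^-1.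
  by have [[z]] := GP (n, l n); exists z.
apply: (@separated_isolated _ _ x y e) => // [m n mn|n|n].
- rewrite leNgt; apply/negP => xmn; have [_] := GP (n, l n); apply.
  by exists (x m); [exact: xl|rewrite metric_sym].
- by have [] := yP n.
- by have [] := yP n.
Qed.

End NearlyIsolated.

Theorem theorem3p5 (R : realType) (X : metricType R)
    (hbb : forall A : set X, bourbaki_bounded A -> totally_bounded A)
    (hring : ucfun_ring X) :
  exists2 L : set X, totally_bounded L &
    forall e : R, 0 < e -> uniformly_isolated (~` enlargement L e).
Proof.
have /choice[N /choice[F NF]] (k : nat) : exists n, exists F : set X,
    finite_set F /\ near_points n `<=` enlargement F k.+1%:R^-1.
  have [|n [F Ff Fn]] := @near_points_net _ X k.+1%:R^-1 hbb hring.
    by rewrite invr_gt0.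
  by exists n, F.
(* Since [N] need not be monotone, intersecting over [i <= k] makes [A] decreasing. *)
pose A k : set X := [set x | forall i, (i <= k)%N -> near_points (N i) x].
(* Points of the nets far from [A k] are dropped: they could spoil the total
   boundedness of the union. *)
exists [set z | exists k, F k z /\ exists2 a, A k a & mdist a z < k.+1%:R^-1].
  move=> e e0; have [k ke] : exists n : nat, n.+1%:R^-1 < e / 2.
    by apply: invSn_lt; rewrite divr_gt0.
  (* A point kept from a later net [F j] is close to some [a] in [A j], hence in
     [near_points (N k)], and [F k] already has a point close to [a]. *)
  exists (\bigcup_(i in `I_k.+1) F i).
    by apply: bigcup_finite => [|i _]; [exact: finite_II|have [] := NF i].
  move=> z [j [Fz [a Aa az]]]; have [jk|kj] := leqP j k.
    by exists z; [exists j|rewrite mdistxx].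
  have [_ /(_ a)[|w Fw aw]] := NF k; first exact/Aa/ltnW.
  exists w; first by exists k => /=.
  have {}az := lt_trans (lt_le_trans az (le_invSn R (ltnW kj))) ke.
  have {}aw := lt_trans aw ke.
  have := metric_triangle z a w; rewrite [mdist z a]metric_sym; lra.
move=> e e0; have [k ke] := invSn_lt e0.
(* The maximum puts [x] in [A k], so [x] itself witnesses that its net point in [F k] was kept. *)
apply: (@isolated_near_points _ _ (\max_(i < k.+1) N i)) => x xL xn; apply: xL.
have Ax : A k x.
  move=> i ik; apply: near_points_le xn.
  by rewrite -ltnS in ik; exact: (leq_bigmax (Ordinal ik)).
have [_ /(_ x)[|z Fz xz]] := NF k; first exact: Ax.
by exists z; [exists k; split => //; exists x|exact: lt_trans ke].
Qed.
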